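(* Let $Z$ be the graph obtained from vertex-disjoint graphs $X$ and $Y$ by joining a vertex $u$ in $X$ to a vertex $v$ in $Y$ by a path $P$ of length at least one. If $u$ and $v$ are cospectral in $Z$, then they are strongly cospectral in $Z$.
   Context: Graphs are finite, simple and undirected. The path $P$ has end-vertices $u$ and $v$; its internal vertices (if any) are new vertices lying in neither $X$ nor $Y$, and length means number of edges (so for length one, $Z$ is obtained by adding the edge $uv$ to the disjoint union of $X$ and $Y$). For a graph $W$ with adjacency matrix $A(W)$, $\phi(W,t)=\det(tI-A(W))$; vertices $u,v$ of $Z$ are cospectral in $Z$ if the vertex-deleted subgraphs satisfy $\phi(Z\setminus u,t)=\phi(Z\setminus v,t)$. Let $E_r$ denote the orthogonal projections onto the distinct eigenspaces of $A(Z)$ and let $e_w$ be the standard basis vectors of $\mathbb{R}^{V(Z)}$. Vertices $u,v$ are strongly cospectral in $Z$ if for each $r$ we have $E_re_u=E_re_v$ or $E_re_u=-E_re_v$. *)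

(* Defs.v *)
From HB Require Import structures.
From mathcomp Require Import all_boot all_order all_algebra.
From mathcomp Require Import reals.

Set Implicit Arguments.
Unset Strict Implicit.
Unset Printing Implicit Defensive.

Import GRing.Theory.
Local Open Scope ring_scope.

Record sgraph (V : finType) := SGraph {
  adj :> rel V;
  adj_sym : symmetric adj;
  adj_irr : irreflexive adj }.

Section DeleteVertex.
Variables (V : finType) (Z : sgraph V) (w : V).

Definition del_adj : rel {x : V | x != w} := fun x y => Z (val x) (val y).

Lemma del_adj_sym : symmetric del_adj.
Proof. by move=> x y; apply: adj_sym. Qed.

Lemma del_adj_irr : irreflexive del_adj.
Proof. by move=> x; apply: adj_irr. Qed.

Definition del_vertex : sgraph {x : V | x != w} :=
  SGraph del_adj_sym del_adj_irr.

End DeleteVertex.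

Section JoinByPath.
Variables (VX VY : finType) (X : sgraph VX) (Y : sgraph VY).
Variables (u : VX) (v : VY).
(* Number of edges of the path; meaningful for 0 < len. *)
Variable len : nat.

(* The last summand consists of the internal vertices of the path. *)
Definition join_vertex : finType := ((VX + VY) + 'I_len.-1)%type.

Definition inX (x : VX) : join_vertex := inl (inl x).
Definition inY (y : VY) : join_vertex := inl (inr y).

(* Position along the path u = p_0, p_1, ..., p_len = v;
   [None] for the vertices that do not lie on it. *)
Definition path_pos (z : join_vertex) : option nat :=
  match z with
  | inl (inl x) => if x == u then Some 0%N else None
  | inl (inr y) => if y == v then Some len else None
  | inr i => Some i.+1
  end.

Definition path_adj : rel join_vertex := fun z z' =>
  match path_pos z, path_pos z' with
  | Some i, Some j => (j == i.+1) || (i == j.+1)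
  | _, _ => false
  end.

Definition union_adj : rel join_vertex := fun z z' =>
  match z, z' with
  | inl (inl x), inl (inl x') => X x x'
  | inl (inr y), inl (inr y') => Y y y'
  | _, _ => false
  end.

Definition join_adj : rel join_vertex :=
  fun z z' => union_adj z z' || path_adj z z'.

Lemma join_adj_sym : symmetric join_adj.
Proof.
move=> z z'; rewrite /join_adj; congr (_ || _).
  by case: z z' => [[x|y]|i] [[x'|y']|i'] //=; apply: adj_sym.
rewrite /path_adj.
by case: (path_pos z) (path_pos z') => [i|] [j|] //; rewrite orbC.
Qed.

Lemma join_adj_irr : irreflexive join_adj.
Proof.
move=> z; rewrite /join_adj /path_adj.
have -> : union_adj z z = false by case: z => [[x|y]|i] //=; apply: adj_irr.
by case: (path_pos z) => //= i; rewrite orbb -[X in X == _]addn0 -addn1 eqn_add2l.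
Qed.

Definition join_by_path : sgraph join_vertex :=
  SGraph join_adj_sym join_adj_irr.

End JoinByPath.

Section Spectral.
Variable R : realType.

Definition adjmx (V : finType) (Z : sgraph V) : 'M[R]_#|V| :=
  \matrix_(i, j) (Z (enum_val i) (enum_val j))%:R.

Definition phi (V : finType) (Z : sgraph V) : {poly R} := char_poly (adjmx Z).

Definition cospectral (V : finType) (Z : sgraph V) (u v : V) : Prop :=
  phi (del_vertex Z u) = phi (del_vertex Z v).

(* Orthogonal projection of R^n onto the row space of U, acting on row vectors
   by right multiplication: the projection onto U along its orthogonal
   complement for the standard inner product.  As it is a symmetric matrix,
   its action on column vectors is the same up to transposition. *)
Definition orth_proj (m n : nat) (U : 'M[R]_(m, n)) : 'M[R]_n :=
  proj_mx <<U>>%MS (orthomx idfun 1%:M U).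

Definition stdvec (V : finType) (w : V) : 'rV[R]_#|V| :=
  delta_mx 0 (enum_rank w).

Definition strongly_cospectral (V : finType) (Z : sgraph V) (u v : V) : Prop :=
  forall theta : R, eigenvalue (adjmx Z) theta ->
    let E := orth_proj (eigenspace (adjmx Z) theta) in
    stdvec u *m E = stdvec v *m E \/ stdvec u *m E = - (stdvec v *m E).

End Spectral.

(* Main.v *)
Require Import Defs.
From mathcomp Require Import all_boot all_order all_algebra all_fingroup.
From mathcomp Require Import reals.
From mathcomp Require Import ring zify.

Set Implicit Arguments.
Unset Strict Implicit.
Unset Printing Implicit Defensive.

Import GRing.Theory Num.Theory.
Local Open Scope ring_scope.

(** Why the theorem holds.  Fix an eigenvalue theta of Z, let U be its
    eigenspace, E the orthogonal projection onto U, and p, q the images under E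
    of the basis vectors of u and v.  Since E is symmetric and idempotent, the
    squared lengths of p and q are the diagonal entries of E at u and v, and
    the value of a vector f of U at u is the inner product of f and p.

    Cospectrality gives p and q equal length.  Indeed phi(Z \ w, t) is the
    diagonal entry at w of the adjugate of tI - A ([phi_del_vertex]), and the
    diagonal entry of E at w is the residue at theta of the quotient of that
    polynomial by phi(Z, t) ([eq_adj_diag_proj]).

    The shape of Z makes p and q parallel.  For f and w in U, write f_0 = f(u)
    and f_1 for the values of f at u and at the next vertex of the path.
    Comparing the inner products of Af with w and of f with Aw over X alone,
    only the single edge leaving X contributes, so f_1 w_0 = w_1 f_0
    ([wronskian_eq]).  Suppose p is nonzero and take w = p, so that w_0 is
    nonzero: if f(u) = 0, then f_1 = 0, and the three-term recurrence along
    the path gives f(v) = 0 ([eigenfunction_vanish]).  So every vector of U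
    orthogonal to p is orthogonal to q, whence q is a multiple of p; having the
    same length, it is p or -p.  If p = 0, then q = 0 by equality of lengths
    ([proj_rows_parallel]). *)

(** * Vertex-deleted characteristic polynomials as cofactors *)

Lemma det_mxsub_inj (R : comPzRingType) (m n : nat) (g : 'I_m -> 'I_n) (A : 'M[R]_n) :
  m = n -> injective g -> \det (mxsub g g A) = \det A.
Proof.
move=> eq_mn; case: n / eq_mn g A => g A g_inj.
have -> : mxsub g g A = row_perm (perm g_inj) (col_perm (perm g_inj) A).
  by apply/matrixP => i j; rewrite !mxE !permE.
rewrite row_permE col_permE !det_mulmx !det_perm odd_permV.
by rewrite [\det A * _]mulrC mulrA -signr_addb addbb mul1r.
Qed.

Lemma phi_del_vertex (R : realType) (V : finType) (Z : sgraph V) (w : V) :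
  phi R (del_vertex Z w) =
  \adj (char_poly_mx (adjmx R Z)) (enum_rank w) (enum_rank w).
Proof.
rewrite mxE /cofactor -signr_odd oddD addbb mul1r.
set h := enum_rank w.
have off_w (j : 'I_(#|V|.-1)) : enum_val (lift h j) != w.
  by apply/eqP => /(congr1 enum_rank); rewrite enum_valK => /eqP;
    rewrite eq_sym (negPf (neq_lift _ _)).
pose g j := enum_rank (Sub (enum_val (lift h j)) (off_w j) : {x | x != w}).
have g_inj : injective g.
  by move=> i j /enum_rank_inj /(congr1 val) /= /enum_val_inj /lift_inj.
have card_w : #|V|.-1 = #|{: {x | x != w}}|.
  by rewrite card_sig -(cardC1 w); apply: eq_card => x; rewrite !inE.
rewrite /phi /char_poly -(det_mxsub_inj _ card_w g_inj); congr (\det _).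
apply/matrixP => i j; rewrite !mxE /= !enum_rankK /=.
by rewrite (inj_eq g_inj) (inj_eq lift_inj).
Qed.

(** * Orthogonal projection onto the kernel of a symmetric matrix *)

(** The diagonal entries of [M *m M^T] are sums of squares. *)
Lemma mulmx_tr_eq0 (R : realDomainType) (m n : nat) (M : 'M[R]_(m, n)) :
  M *m M^T = 0 -> M = 0.
Proof.
move=> MM0; apply/matrixP => i j; rewrite mxE; apply/eqP.
have := congr1 (fun P : 'M_m => P i i) MM0; rewrite !mxE.
under eq_bigr do rewrite mxE -expr2.
move=> /eqP; rewrite psumr_eq0 => [/allP /(_ j)|k _]; last exact: sqr_ge0.
by rewrite mem_index_enum sqrf_eq0 => /(_ isT).
Qed.

(** A real symmetric [B] has the same row space as its square.  The matrix [D]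
    expresses this by an equation, which makes [1%:M - D *m B] an explicit
    formula for the projection onto the kernel of [B]. *)
Lemma symmetric_left_regular (R : realFieldType) (n : nat) (B : 'M[R]_n) :
  B^T = B -> exists D, B = D *m B *m B.
Proof.
move=> symB; suff /submxP[D defB] : (B <= B *m B)%MS by exists D; rewrite -mulmxA.
(* With M := B coker(B^2) one has B M = 0, hence M^T M = 0. *)
set M := B *m cokermx (B *m B).
have BM0 : B *m M = 0 by rewrite /M mulmxA mulmx_coker.
have /(congr1 trmx) : M^T = 0.
  by apply: mulmx_tr_eq0; rewrite trmxK {1}/M trmx_mul symB -mulmxA BM0 mulmx0.
by rewrite trmxK trmx0 submxE -/M => ->.
Qed.

Section Projection.
Variables (R : realFieldType) (n : nat) (B D : 'M[R]_n).
Hypotheses (symB : B^T = B) (BD : B = D *m B *m B).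

Let E := 1%:M - D *m B.

Lemma kerproj_mulB : E *m B = 0.
Proof. by rewrite mulmxBl mul1mx -BD subrr. Qed.

Lemma kerproj_mul_tr : E *m E^T = E.
Proof.
rewrite [E^T]linearB /= trmx1 trmx_mul symB mulmxBr mulmx1 mulmxA.
by rewrite kerproj_mulB mul0mx subr0.
Qed.

Lemma kerproj_tr : E^T = E.
Proof. by rewrite -[in LHS]kerproj_mul_tr trmx_mul trmxK kerproj_mul_tr. Qed.

Lemma kerproj_id m (f : 'M_(m, n)) : f *m B = 0 -> f *m E = f.
Proof.
move=> fB0; rewrite -kerproj_tr [E^T]linearB /= trmx1 trmx_mul symB.
by rewrite mulmxBr mulmx1 mulmxA fB0 mul0mx subr0.
Qed.

End Projection.

(** [E] fixes the kernel of [B], and [D *m B] has its rows in the row space of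
    the symmetric matrix [B], which is orthogonal to that kernel. *)
Lemma orth_proj_kermx (R : realType) (n : nat) (B D : 'M[R]_n) :
  B^T = B -> B = D *m B *m B -> orth_proj (kermx B) = 1%:M - D *m B.
Proof.
move=> symB BD; set E := 1%:M - D *m B.
pose W := orthomx idfun 1%:M (kermx B).
have inW m (f : 'M_(m, n)) : (f <= W)%MS = (f *m (kermx B)^T == 0).
  rewrite /W /orthomx sub_kermx mul1mx; congr (_ *m _ == 0).
  by apply/matrixP => i j; rewrite !mxE.
have disj : (<<kermx B>> :&: W = 0)%MS.
  set M := (_ :&: _)%MS; apply: mulmx_tr_eq0.
  have : (M <= kermx B)%MS by rewrite -(genmxE (kermx B)) capmxSl.
  move=> /submxP[G defM]; rewrite {2}defM trmx_mul mulmxA.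
  by have /eqP-> : M *m (kermx B)^T == 0; rewrite ?mul0mx // -inW capmxSr.
have -> : orth_proj (kermx B) = (E + D *m B) *m proj_mx <<kermx B>>%MS W.
  by rewrite subrK mul1mx.
rewrite mulmxDl proj_mx_id ?proj_mx_0 ?addr0 //.
  rewrite inW -mulmxA -[X in X *m _^T]trmxK -trmx_mul symB mulmx_ker.
  by rewrite trmx0 mulmx0.
by rewrite genmxE sub_kermx kerproj_mulB.
Qed.

(** * The diagonal of a spectral projection as a residue *)

Section Resolvent.
Variables (R : realFieldType) (n : nat) (A D : 'M[R]_n) (theta : R).
Let B := A - theta%:M.
Hypothesis BD : B = D *m B *m B.

Local Notation "M ^P" := (map_mx polyC M) (at level 2, format "M ^P").
Local Notation T := ('X - theta%:P).
Local Notation C := (char_poly_mx A).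
Local Notation N := (\adj C).
Local Notation phiA := (char_poly A).

Lemma mulB_adj : B^P *m N = T *: N - phiA%:M.
Proof.
have -> : B^P = T%:M - C.
  by apply/matrixP => i j; rewrite !mxE polyCB polyCMn mulrnBl; ring.
by rewrite mulmxBl mul_scalar_mx mul_mx_adj.
Qed.

(** Since [D *m B] is also [D ^+ k *m B ^+ k], and [B] acts on the adjugate as
    [T] modulo the characteristic polynomial, the component of the adjugate off
    the kernel of [B] is divisible by every power of [T] modulo the
    characteristic polynomial. *)
Lemma image_part_expansion (k : nat) : exists Q G : 'M_n,
  (D *m B)^P *m N = phiA *: Q + T ^+ k *: (G *m B^P *m N).
Proof.
elim: k => [|k [Q [G IH]]].
  by exists 0, D^P; rewrite scaler0 add0r scale1r map_mxM.
exists (Q - T ^+ k *: (G *m (D *m B)^P)), (G *m D^P).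
have BP : B^P = D^P *m B^P *m B^P by rewrite -!map_mxM -BD.
have step : G *m B^P *m N =
    T *: (G *m D^P *m B^P *m N) - phiA *: (G *m (D *m B)^P).
  rewrite {1}BP map_mxM !mulmxA -[_ *m B^P *m N in LHS]mulmxA mulB_adj mulmxBr.
  by rewrite -scalemxAr mul_mx_scalar.
rewrite IH step scalerBr scalerA -exprSr scalerBr addrA [RHS]addrAC.
by rewrite !scalerA [phiA * _]mulrC.
Qed.

(** The identity for the residue of the resolvent at theta, with denominators
    cleared: dividing by the characteristic polynomial, [T] times the resolvent
    is the projection modulo [T] and a remainder that vanishes to high order
    once [k] exceeds the degree. *)
Lemma residue_expansion (k : nat) : exists Q G : 'M_n,
  phiA *: (1%:M - D *m B)^P = T *: N - (T * phiA) *: Q - T ^+ k *: G.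
Proof.
have [Q [G EX]] := image_part_expansion k.
exists Q, (T *: (G *m B^P *m N)).
set E := 1%:M - D *m B.
have EB0 : E *m B = 0 by rewrite mulmxBl mul1mx -BD subrr.
have : E^P *m B^P *m N = 0 by rewrite -map_mxM EB0 map_mx0 mul0mx.
rewrite -mulmxA mulB_adj mulmxBr mul_mx_scalar -scalemxAr => /eqP.
rewrite subr_eq0 => /eqP <-.
rewrite /E map_mxB map_mx1 mulmxBl mul1mx EX scalerBr scalerDr opprD addrA.
by rewrite !scalerA [T ^+ k * T]mulrC.
Qed.

(** If the diagonal entries of the projection differed, the factor [q] below
    would be coprime to [T], so that [T ^+ n.+1] would divide the
    characteristic polynomial, whose degree is [n]. *)
Lemma eq_adj_diag_proj (i j : 'I_n) : N i i = N j j ->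
  (1%:M - D *m B) i i = (1%:M - D *m B) j j.
Proof.
move=> eqN; set E := 1%:M - D *m B.
apply/eqP; rewrite -subr_eq0; apply/negPn/negP => neq0.
have [Q [G EX]] := residue_expansion (n.+1).
pose q := (E i i - E j j)%:P + T * (Q i i - Q j j).
have dvd_phi : T ^+ n.+1 %| phiA * q.
  have eqE l : phiA * (E l l)%:P = T * N l l - T * phiA * Q l l - T ^+ n.+1 * G l l.
    by have := congr1 (fun M : 'M_n => M l l) EX; rewrite !mxE.
  have -> : phiA * q = T ^+ n.+1 * (G j j - G i i).
    rewrite /q polyCB mulrDr mulrBr !eqE eqN; ring.
  exact: dvdp_mulr.
have co : coprimep (T ^+ n.+1) q.
  apply: coprimep_expl; rewrite coprimep_sym coprimep_XsubC /root /q.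
  by rewrite hornerD hornerM hornerXsubC subrr mul0r addr0 hornerC.
move: dvd_phi; rewrite Gauss_dvdpl // => /dvdp_leq.
by rewrite size_exp_XsubC size_char_poly ltnn monic_neq0 ?char_poly_monic // => /(_ isT).
Qed.

End Resolvent.

(** * Parallel rows of a projection *)

(** Rows [i] and [j] of [E] have squared lengths [E i i] and [E j j], and pair
    with a vector [f] of the image to its coordinates at [i] and [j].  The
    component [f] of row [j] orthogonal to row [i] vanishes at [i], hence at
    [j]; so it is orthogonal to both rows, and to itself. *)
Lemma proj_rows_parallel (R : realFieldType) (n : nat) (E : 'M[R]_n) (i j : 'I_n) :
  E^T = E -> E *m E = E -> E i i = E j j ->
  (forall f : 'rV_n, f *m E = f -> E i i != 0 -> f 0 i = 0 -> f 0 j = 0) ->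
  row i E = row j E \/ row i E = - row j E.
Proof.
move=> symE idE eqE vanish.
have symE' a b : E a b = E b a by rewrite -[in LHS]symE mxE.
have dot_row (f : 'rV_n) a : f *m E = f -> f *m (row a E)^T = (f 0 a)%:M.
  move=> fE; rewrite tr_row symE -{2}fE; apply/matrixP => x y; rewrite !ord1 !mxE mulr1n.
  by apply: eq_bigr => l _; rewrite mxE.
have rowE_id a : row a E *m E = row a E by rewrite -row_mul idE.
have [E0|E_neq0] := eqVneq (E i i) 0.
  have row0 a : E a a = 0 -> row a E = 0.
    move=> Ea0; apply: mulmx_tr_eq0; rewrite dot_row // mxE Ea0.
    by apply/matrixP => x y; rewrite !mxE mul0rn.
  by left; rewrite !row0 // -eqE.
pose k := E i j / E i i; pose f := row j E - k *: row i E.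
have fE : f *m E = f by rewrite mulmxBl -scalemxAl !rowE_id.
have fi0 : f 0 i = 0 by rewrite !mxE divfK // symE' subrr.
have fj0 : f 0 j = 0 by apply: vanish.
have /eqP : f = 0.
  apply: mulmx_tr_eq0; rewrite {2}/f linearB linearZ /= mulmxBr -scalemxAr.
  by rewrite !dot_row // fi0 fj0 scale_scalar_mx mulr0 subrr.
rewrite subr_eq0 => /eqP rowj.
have : k ^+ 2 == 1.
  move: fj0; rewrite !mxE -eqE => /eqP; rewrite subr_eq0 => /eqP Ek.
  apply/eqP/(mulIf E_neq0); rewrite mul1r expr2 -mulrA [RHS]Ek; congr (_ * _).
  by rewrite divfK.
rewrite sqrf_eq1 => /orP[] /eqP k1; [left|right]; rewrite rowj k1.
  by rewrite scale1r.
by rewrite scaleN1r opprK.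
Qed.

(** * Eigenvectors of two graphs joined by a path *)

Section EigenvectorsOnJoin.
Variables (R : comPzRingType) (VX VY : finType) (X : sgraph VX) (Y : sgraph VY).
Variables (u : VX) (v : VY) (len : nat).
Hypothesis len_gt0 : (0 < len)%N.

Local Notation V := (join_vertex VX VY len).
Local Notation Z := (join_by_path X Y u v len).
Local Notation pos := (path_pos u v).

(** The value of [F] at the vertex in position [k] of the path.  Summing over
    the vertices in that position avoids choosing this vertex by cases on
    whether it is [u], internal or [v]. *)
Definition path_value (F : V -> R) (k : nat) : R :=
  \sum_(z | pos z == Some k) F z.

Definition is_eigenfunction (theta : R) (F : V -> R) :=
  forall z, \sum_z' F z' * (Z z' z)%:R = theta * F z.

Lemma path_value_at (F : V -> R) (z : V) (k : nat) :
  (forall z', (pos z' == Some k) = (z' == z)) -> path_value F k = F z.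
Proof. by move=> posE; rewrite /path_value (eq_bigl _ _ posE) big_pred1_eq. Qed.

Lemma path_value_start F : path_value F 0 = F (inX VY len u).
Proof.
apply: path_value_at => -[[x|y]|i] //=.
  by rewrite /inX; case: (x =P u) => [->|ne]; rewrite ?eqxx //; apply/esym/eqP => -[].
by case: (y == v) => //=; apply/eqP => -[] len0; move: (len_gt0); rewrite len0.
Qed.

Lemma path_value_end F : path_value F len = F (inY VX len v).
Proof.
apply: path_value_at => -[[x|y]|i] //=.
- by case: (x == u) => //=; apply/eqP => -[] len0; move: (len_gt0); rewrite -len0.
- by rewrite /inY; case: (y =P v) => [->|ne]; rewrite ?eqxx //; apply/esym/eqP => -[].
by apply/eqP => -[] eq_len; have := ltn_ord i; lia.
Qed.

Lemma path_value_internal F (i : 'I_len.-1) : path_value F i.+1 = F (inr i).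
Proof.
apply: path_value_at => -[[x|y]|j] //=; first by case: ifP.
case: ifP => // _; apply/eqP => -[] eq_len.
by have := ltn_ord i; lia.
Qed.

Lemma sum_path_adj F z k : pos z = Some k ->
  \sum_z' F z' * (path_adj u v z' z)%:R =
  path_value F k.+1 + (if k is k'.+1 then path_value F k' else 0).
Proof.
move=> posz; rewrite /path_value [in RHS]big_mkcond /=.
have -> : (if k is k'.+1 then \sum_(z | pos z == Some k') F z else 0) =
    \sum_z' (if omap S (pos z') == Some k then F z' else 0).
  case: (k) => [|k']; last rewrite big_mkcond.
    by rewrite big1 // => z' _; case: (pos z').
  by apply: eq_bigr => z' _; case: (pos z').
rewrite -big_split; apply: eq_bigr => z' _ /=.
rewrite /path_adj posz; case: (pos z') => [j|] /=; last by rewrite mulr0 addr0.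
rewrite /eq_op /= -!/(eq_op _ _) [k == _]eq_sym.
case: (j =P k.+1) => [->|_]; case: eqP => //=; rewrite ?mulr1 ?mulr0 ?addr0 ?add0r //.
by move=> /eqP; rewrite -addn2 -[X in _ == X]addn0 eqn_add2l.
Qed.

Lemma eigenfunction_inX theta F x : is_eigenfunction theta F ->
  \sum_x' F (inX VY len x') * (X x' x)%:R + path_value F 1 * (x == u)%:R =
  theta * F (inX VY len x).
Proof.
move=> <-.
have -> : \sum_x' F (inX VY len x') * (X x' x)%:R =
    \sum_z' F z' * (union_adj X Y z' (inX VY len x))%:R.
  rewrite !big_sumType /= [X in _ = _ + X]big1 ?addr0 => [|i _]; last by rewrite mulr0.
  by rewrite [X in _ = _ + X]big1 ?addr0 // => i _; rewrite mulr0.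
have -> : path_value F 1 * (x == u)%:R =
    \sum_z' F z' * (path_adj u v z' (inX VY len x))%:R.
  case: (x =P u) => [->|/eqP ne];
    first by rewrite (@sum_path_adj _ _ 0) /= ?eqxx // mulr1 addr0.
  rewrite mulr0 big1 // => z' _; rewrite /path_adj /= (negPf ne).
  by case: (pos z') => *; rewrite mulr0.
rewrite -big_split; apply: eq_bigr => z' _ /=; rewrite -mulrDr -natrD; congr (_ * _%:R).
rewrite /join_adj; case: (boolP (union_adj _ _ _ _)) => //= uz.
suff -> : path_adj u v z' (inX VY len x) = false by [].
move: uz; rewrite /path_adj; case: z' => [[x'|]|] //= _.
by case: (x' == u); case: (x == u).
Qed.

Lemma eigenfunction_internal theta F k : is_eigenfunction theta F ->
  (k.+1 < len)%N ->
  path_value F k.+2 + path_value F k = theta * path_value F k.+1.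
Proof.
move=> eigF k_lt; have k_lt' : (k < len.-1)%N by rewrite -ltnS prednK.
rewrite (path_value_internal F (Ordinal k_lt')) -eigF.
rewrite -(@sum_path_adj F (inr (Ordinal k_lt')) k.+1) //.
apply: eq_bigr => z' _ /=; rewrite /join_adj.
by case: z' => [[x|y]|i].
Qed.

(** Green's identity on [X]: the edges inside [X] contribute symmetrically in
    [F] and [G], and the only other edge meeting [X] is the first edge of the
    path. *)
Lemma wronskian_eq theta F G : is_eigenfunction theta F -> is_eigenfunction theta G ->
  path_value F 1 * G (inX VY len u) = path_value G 1 * F (inX VY len u).
Proof.
move=> eigF eigG.
pose S (F' G' : V -> R) :=
  \sum_x (\sum_x' F' (inX VY len x') * (X x' x)%:R) * G' (inX VY len x).
have SC : S F G = S G F.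
  rewrite /S; under eq_bigr do rewrite mulr_suml.
  rewrite exchange_big /=; apply: eq_bigr => x _; rewrite mulr_suml.
  by apply: eq_bigr => x' _; rewrite adj_sym; ring.
have green F' G' : is_eigenfunction theta F' ->
    S F' G' + path_value F' 1 * G' (inX VY len u) =
    theta * \sum_x F' (inX VY len x) * G' (inX VY len x).
  move=> eigF'; rewrite mulr_sumr.
  under [RHS]eq_bigr do rewrite mulrA -(eigenfunction_inX _ eigF') mulrDl.
  rewrite big_split /=; congr (_ + _).
  rewrite (bigD1 u) //= big1 ?addr0 ?eqxx ?mulr1 // => x /negPf->.
  by rewrite mulr0 mul0r.
apply: (addrI (S F G)); rewrite green // [in RHS]SC green //.
by congr (_ * _); apply: eq_bigr => x _; rewrite mulrC.
Qed.

(** Two consecutive zeros propagate along the three-term recurrence. *)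
Lemma path_value_eq0 theta F : is_eigenfunction theta F ->
  path_value F 0 = 0 -> path_value F 1 = 0 ->
  forall k, (k <= len)%N -> path_value F k = 0.
Proof.
move=> eigF F0 F1 k.
suff: (k <= len)%N -> path_value F k = 0 /\
    ((k < len)%N -> path_value F k.+1 = 0).
  by move=> H /H[].
elim: k => [|k IH] k_le; first by [].
have [Fk Fk1] := IH (ltnW k_le); split=> [|lt_k]; first exact: Fk1.
have := eigenfunction_internal eigF lt_k.
by rewrite Fk Fk1 // mulr0 addr0.
Qed.

End EigenvectorsOnJoin.

(** If the eigenfunction [F] vanishes at [u] while [G] does not, the Wronskian
    identity forces [F] to vanish at the next vertex of the path as well, and
    two consecutive zeros propagate to the other end. *)
Lemma eigenfunction_vanish (R : idomainType) (VX VY : finType)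
    (X : sgraph VX) (Y : sgraph VY) (u : VX) (v : VY) (len : nat) (theta : R)
    (F G : join_vertex VX VY len -> R) : (0 < len)%N ->
  is_eigenfunction X Y u v theta F -> is_eigenfunction X Y u v theta G ->
  F (inX VY len u) = 0 -> G (inX VY len u) != 0 -> F (inY VX len v) = 0.
Proof.
move=> len_gt0 eigF eigG Fu0 Gu_neq0.
have := wronskian_eq eigF eigG; rewrite Fu0 mulr0 => /eqP.
rewrite mulf_eq0 (negPf Gu_neq0) orbF => /eqP F1.
rewrite -(path_value_end u v len_gt0).
by apply: (path_value_eq0 len_gt0 eigF); rewrite ?(path_value_start u v len_gt0).
Qed.

Lemma eigenfunction_of_row (R : realType) (VX VY : finType)
    (X : sgraph VX) (Y : sgraph VY) (u : VX) (v : VY) (len : nat) (theta : R)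
    (f : 'rV[R]_#|join_vertex VX VY len|) :
  f *m adjmx R (join_by_path X Y u v len) = theta *: f ->
  is_eigenfunction X Y u v theta (fun z => f 0 (enum_rank z)).
Proof.
move=> eigf z; have := congr1 (fun g : 'rV_ _ => g 0 (enum_rank z)) eigf.
rewrite /= [X in X = _ -> _]mxE [X in _ = X -> _]mxE => <-.
rewrite (reindex (@enum_val _ predT)) /=; last exact: onW_bij (enum_val_bij _).
by apply: eq_bigr => i _; rewrite mxE enum_rankK enum_valK.
Qed.

Theorem theorem9p1 (R : realType) (VX VY : finType)
    (X : sgraph VX) (Y : sgraph VY) (u : VX) (v : VY)
    (len : nat) (len_gt0 : (0 < len)%N) :
  let Z := join_by_path X Y u v len in
  cospectral R Z (inX VY len u) (inY VX len v) ->
  strongly_cospectral R Z (inX VY len u) (inY VX len v).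
Proof.
move=> Z; rewrite /cospectral !phi_del_vertex => cosp theta _ /=.
set A := adjmx R Z in cosp *.
have symB : (A - theta%:M)^T = A - theta%:M.
  rewrite linearB /= tr_scalar_mx; congr (_ - _).
  by apply/matrixP => i j; rewrite !mxE adj_sym.
have [D BD] := symmetric_left_regular symB.
rewrite [orth_proj _](orth_proj_kermx symB BD) /stdvec -!rowE.
have EB := kerproj_mulB BD.
apply: proj_rows_parallel => [|||f fE E_neq0 fu0].
- exact: (kerproj_tr symB BD).
- exact: (kerproj_id symB BD).
- exact: (eq_adj_diag_proj BD).
set E := 1%:M - _ in fE E_neq0 EB.
have eig (g : 'rV_ _) : g *m (A - theta%:M) = 0 ->
    is_eigenfunction X Y u v theta (fun z => g 0 (enum_rank z)).
  move=> /eqP; rewrite mulmxBr mul_mx_scalar subr_eq0 => /eqP.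
  exact: eigenfunction_of_row.
have eigf := eig f; rewrite -{1}fE -mulmxA EB mulmx0 in eigf.
(* The projection of u itself is the eigenvector that is nonzero at u. *)
have eigE := eig (row (enum_rank (inX VY len u)) E).
rewrite -row_mul EB row0 in eigE.
apply: (eigenfunction_vanish len_gt0 (eigf erefl) (eigE erefl)) => //.
by rewrite mxE.
Qed.
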